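(* Let $V$ be the Volterra operator on $L^2[0,1]$, $Vf(t)=\int_0^t f(s)\,ds$. Then for every nonzero $f\in L^2[0,1]$, $k_f>0$. In other words, $0\notin\Lambda(V)$.
   Context: For quasinilpotent $T$ and $x\neq 0$, $k_x=k_x(T)=\limsup_{\lambda\to0}\frac{\ln\|(\lambda-T)^{-1}x\|}{\ln\|(\lambda-T)^{-1}\|}$, and $\Lambda(T)=\{k_x(T): x\neq0\}$. Here $T=V$. *)

(* Defs.v *)
(* Complex numbers / complex-valued functions are
   represented as pairs of real numbers / pairs of real functions (real part,
   imaginary part), since MathComp-Analysis has no complex-valued integration. *)
From HB Require Import structures.
From mathcomp Require Import all_boot all_order all_algebra.
From mathcomp Require Import all_classical all_reals all_analysis.
Set Implicit Arguments. Unset Strict Implicit. Unset Printing Implicit Defensive.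
Import Order.TTheory GRing.Theory Num.Theory.
Import numFieldNormedType.Exports.
Local Open Scope classical_set_scope.
Local Open Scope ring_scope.

Definition I01 (R : realType) : set R := `[0%R, 1%R].
Arguments I01 R : clear implicits.

(* complex-valued functions on [0,1]: (real part, imaginary part) *)
Definition cfun (R : realType) := ((R -> R) * (R -> R))%type.

Definition sqint (R : realType) (h : R -> R) : \bar R :=
  (\int[@lebesgue_measure R]_(x in I01 R) ((h x) ^+ 2)%:E)%E.

Definition inL2 (R : realType) (f : cfun R) : Prop :=
  [/\ measurable_fun (I01 R) f.1, measurable_fun (I01 R) f.2,
      (sqint f.1 < +oo)%E & (sqint f.2 < +oo)%E].

Definition L2norm (R : realType) (f : cfun R) : R :=
  Num.sqrt (fine (sqint f.1 + sqint f.2)%E).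

Definition L2eq (R : realType) (f g : cfun R) : Prop :=
  {ae @lebesgue_measure R, forall x, I01 R x -> f.1 x = g.1 x /\ f.2 x = g.2 x}.

Definition volterra (R : realType) (f : cfun R) : cfun R :=
  (fun t => Rintegral (@lebesgue_measure R) `[0%R, t] f.1,
   fun t => Rintegral (@lebesgue_measure R) `[0%R, t] f.2).

(* (lambda - V) g, with lambda = lam.1 + i lam.2 *)
Definition lamV (R : realType) (lam : R * R) (g : cfun R) : cfun R :=
  (fun t => lam.1 * g.1 t - lam.2 * g.2 t - (volterra g).1 t,
   fun t => lam.1 * g.2 t + lam.2 * g.1 t - (volterra g).2 t).

Definition is_resolvent (R : realType) (lam : R * R) (x g : cfun R) : Prop :=
  inL2 g /\ L2eq (lamV lam g) x.

(* || (lambda - V)^{-1} x ||  (the solution g is unique in L^2 for lambda <> 0) *)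
Definition res_vec_norm (R : realType) (lam : R * R) (x : cfun R) : R :=
  sup [set L2norm g | g in is_resolvent lam x].

Definition res_op_norm (R : realType) (lam : R * R) : R :=
  sup [set res_vec_norm lam x | x in [set x | inL2 x /\ L2norm x <= 1]].

Definition k_vec (R : realType) (x : cfun R) : \bar R :=
  limf_esup (fun lam : R * R =>
               (ln (res_vec_norm lam x) / ln (res_op_norm lam))%:E)
            ((0%R, 0%R) : R * R)^'.

(* Main.v *)
(** Suppose [k_f <= 0] and take [lambda = 1/m] with [m] a large integer.  Since
    [ln ||(1/m - V)^{-1}||] lies between [0] and a multiple of [m], the norm of
    [g = (1/m - V)^{-1} f] is at most [exp(eps m)] for every [eps > 0] and all
    large [m].  The primitive of [g] at [1] is
    [m * \int_0^1 exp(m(1-s)) f(s) ds], so the exponential moments of [f] grow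
    subexponentially.  A polynomial in [exp(n(t-s))] that tends to the indicator
    of [s > t] turns this into [\int_t^1 f = \int_0^1 f] for all [t < 1]: its
    coefficients decay like [exp(-kn(1-t))] against the moment of index [kn].
    Hence every [\int_0^t f] vanishes, and so does [f] almost everywhere. *)
Require Import Defs.
From HB Require Import structures.
From mathcomp Require Import all_boot all_order all_algebra.
From mathcomp Require Import all_classical all_reals all_analysis.
From mathcomp Require Import measurable_realfun.
From mathcomp Require Import ring lra.
Set Implicit Arguments. Unset Strict Implicit. Unset Printing Implicit Defensive.
Import Order.TTheory GRing.Theory Num.Theory.
Import numFieldNormedType.Exports.
Local Open Scope classical_set_scope.
Local Open Scope ring_scope.

Section triangle.
Context {R : realType}.
Notation mu := (@lebesgue_measure R).

Lemma integrable_EFin_patch (D : set R) (h : R -> R) : measurable D ->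
  mu.-integrable D (EFin \o h) -> mu.-integrable setT (EFin \o (h \_ D)).
Proof. by move=> mD; rewrite integrable_mkcond// restrict_EFin. Qed.

Lemma Rintegral_triangle (t : R) (phi h : R -> R) :
  mu.-integrable `[0%R, t] (EFin \o phi) ->
  mu.-integrable `[0%R, t] (EFin \o h) ->
  Rintegral mu `[0%R, t] (fun s => phi s * Rintegral mu `[0%R, s] h) =
  Rintegral mu `[0%R, t] (fun u => Rintegral mu `[u, t] phi * h u).
Proof.
move=> iphi ih.
set D := `[0%R, t]%classic.
have mD : measurable D by exact: measurable_itv.
have iP := integrable_EFin_patch mD iphi.
have iH := integrable_EFin_patch mD ih.
set P := phi \_ D in iP; set H := h \_ D in iH.
have mP : measurable_fun setT P.
  by apply/measurable_EFinP; exact: measurable_int iP.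
have mH : measurable_fun setT H.
  by apply/measurable_EFinP; exact: measurable_int iH.
pose K (p : R * R) : \bar R := (if p.2 <= p.1 then P p.1 * H p.2 else 0)%:E.
have mK : measurable_fun [set: R * R] K.
  apply/measurable_EFinP; apply: measurable_fun_ifT => //.
    exact: measurable_fun_ler.
  by apply: measurable_funM; exact: measurableT_comp.
have iK : (mu \x mu)%E.-integrable [set: R * R] K.
  apply/integrable12ltyP => //.
  have aH : (\int[mu]_y `|(EFin \o H) y| < +oo)%E by case/integrableP : iH.
  have mA : measurable_fun setT (abse \o (EFin \o H)).
    by apply: measurableT_comp => //; exact: measurable_int iH.
  apply: (@le_lt_trans _ _
      (\int[mu]_x ((\int[mu]_y `|(EFin \o H) y|) * `|(EFin \o P) x|))%E).
    apply: ge0_le_integral => //.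
    - by move=> x _; exact: integral_ge0.
    - apply: (measurable_fun_fubini_tonelli_F (m2 := mu) (abse \o K)) => //=.
      exact: measurableT_comp.
    - apply: measurable_funeM.
      by apply: measurableT_comp => //; exact: measurable_int iP.
    move=> x _; rewrite muleC -ge0_integralZl//.
    apply: ge0_le_integral => //.
    - by apply: measurableT_comp => //; apply: measurableT_comp mK _.
    - exact: measurable_funeM.
    move=> y _; rewrite /K /=; case: ifPn => _.
      by rewrite normrM EFinM.
    by rewrite normr0 -EFinM lee_fin mulr_ge0.
  rewrite -(@fineK _ (\int[mu]_y `|(EFin \o H) y|)%E); last first.
    by rewrite ge0_fin_numE// integral_ge0.
  rewrite ge0_integralZl//.
  - rewrite lte_mul_pinfty//; first by rewrite lee_fin fine_ge0// integral_ge0.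
    by case/integrableP : iP.
  - by apply: measurableT_comp => //; exact: measurable_int iP.
  - by rewrite lee_fin fine_ge0// integral_ge0.
have := Fubini iK.
have fin1 s : D s ->
    (\int[mu]_(u in `[0%R, s]) (h u)%:E)%E = (Rintegral mu `[0%R, s] h)%:E.
  rewrite /D /= in_itv /= => /andP[s0 st].
  rewrite /Rintegral fineK//; apply: integrable_fin_num => //.
  by apply: integrableS ih => //; apply: subset_itvl; rewrite bnd_simp.
have fin2 u : D u ->
    (\int[mu]_(s in `[u, t]) (phi s)%:E)%E = (Rintegral mu `[u, t] phi)%:E.
  rewrite /D /= in_itv /= => /andP[s0 st].
  rewrite /Rintegral fineK//; apply: integrable_fin_num => //.
  by apply: integrableS iphi => //; apply: subset_itvr; rewrite bnd_simp.
have -> : (\int[mu]_x \int[mu]_y K (x, y) =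
    \int[mu]_(s in D) (phi s * Rintegral mu `[0%R, s] h)%:E)%E.
  rewrite [RHS]integral_mkcond; apply: eq_integral => s _.
  rewrite patchE; case: ifPn => [|/negP]; rewrite inE => Ds; last first.
    by rewrite integral0_eq// => y _; rewrite /K/= /P patchE memNset// mul0r if_same.
  have /andP[s0 st] : 0 <= s <= t by move: Ds; rewrite /D /= in_itv.
  rewrite EFinM -fin1//.
  rewrite -integralZl//; last first.
    by apply: integrableS ih => //; apply: subset_itvl; rewrite bnd_simp.
  rewrite [RHS]integral_mkcond; apply: eq_integral => u _.
  rewrite /K/= /P /H !patchE mem_set// /D !mem_setE !in_itv/=.
  have [us|us] := leP u s; rewrite ?andbF ?mule0// andbT (le_trans us st) andbT.
  by case: ifP => _; rewrite ?mule0 ?mulr0.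
have -> : (\int[mu]_y \int[mu]_x K (x, y) =
    \int[mu]_(u in D) (Rintegral mu `[u, t] phi * h u)%:E)%E.
  rewrite [RHS]integral_mkcond; apply: eq_integral => u _.
  rewrite patchE; case: ifPn => [|/negP]; rewrite inE => Du; last first.
    by rewrite integral0_eq// => x _; rewrite /K/= /H patchE memNset// mulr0 if_same.
  have /andP[u0 ut] : 0 <= u <= t by move: Du; rewrite /D /= in_itv.
  rewrite mulrC EFinM -fin2//.
  rewrite -integralZl//; last first.
    by apply: integrableS iphi => //; apply: subset_itvr; rewrite bnd_simp.
  rewrite [RHS]integral_mkcond; apply: eq_integral => s _.
  rewrite /K/= /P /H !patchE (mem_set Du) /D !mem_setE !in_itv/=.
  have [us|us] := leP u s; rewrite ?mule0//= (le_trans u0 us)/=.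
  by case: ifP => _; rewrite ?mule0 ?mul0r// EFinM muleC.
by move=> /(congr1 fine).
Qed.
End triangle.

Section exponential_weights.
Context {R : realType}.
Notation mu := (@lebesgue_measure R).

Lemma integrable_EFinZl (D : set R) (k : R) (h : R -> R) : measurable D ->
  mu.-integrable D (EFin \o h) -> mu.-integrable D (EFin \o (fun s => k * h s)).
Proof.
move=> mD ih; rewrite (_ : _ \o _ = (fun s => k%:E * (EFin \o h) s)%E)//.
exact: integrableZl.
Qed.

Lemma integrable_EFinD (D : set R) (g h : R -> R) : measurable D ->
  mu.-integrable D (EFin \o g) -> mu.-integrable D (EFin \o h) ->
  mu.-integrable D (EFin \o (fun s => g s + h s)).
Proof.
move=> mD ig ih; rewrite (_ : _ \o _ = (EFin \o g) \+ (EFin \o h))%E//.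
exact: integrableD.
Qed.

Lemma integrable_continuousM (a b : R) (phi h : R -> R) :
  {within `[a, b], continuous phi} ->
  mu.-integrable `[a, b] (EFin \o h) ->
  mu.-integrable `[a, b] (EFin \o (fun s => phi s * h s)).
Proof.
move=> cphi ih.
have mphi : measurable_fun `[a, b] phi.
  exact: subspace_continuous_measurable_fun.
have bphi : bounded_set (phi @` `[a, b]).
  apply: compact_bounded; apply: continuous_compact => //.
  exact: segment_compact.
have [M [_ HM]] := bphi.
pose C := M + 1.
have phiC s : s \in `[a, b] -> `|phi s| <= C.
  by move=> sab; apply: (HM C); [rewrite /C ltrDl|exists s].
apply: (@le_integrable _ _ _ mu _ _ _ (fun s => C%:E * (EFin \o h) s)%E) => //.
- apply/measurable_EFinP; apply: measurable_funM => //.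
  by apply/measurable_EFinP; exact: measurable_int ih.
- move=> s sab; rewrite /= lee_fin !normrM ler_wpM2r//.
  by rewrite (le_trans (phiC s sab))// ler_norm.
- exact: integrableZl.
Qed.

Lemma within_continuous_expRM (A : set R) (c : R) :
  {within A, continuous (fun s => expR (c * s))}.
Proof.
apply: continuous_subspaceT => s.
apply: continuous_comp; [exact: mulrl_continuous|exact: continuous_expR].
Qed.

Lemma within_continuous_primitive (a b : R) (h : R -> R) :
  mu.-integrable `[a, b] (EFin \o h) ->
  {within `[a, b], continuous (fun t => Rintegral mu `[a, t] h)}.
Proof.
have [ab|ba] := leP a b; first exact: parameterized_integral_continuous.
by move=> _; rewrite set_itv_ge -?ltNge//; exact: continuous_subspace0.
Qed.

Lemma continuous_itv_integrable (a b : R) (phi : R -> R) :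
  {within `[a, b], continuous phi} ->
  mu.-integrable `[a, b] (EFin \o phi).
Proof.
move=> cphi.
by apply: (@continuous_compact_integrable R) => //; exact: segment_compact.
Qed.

Lemma Rintegral_expRM (c u t : R) : u <= t ->
  Rintegral mu `[u, t] (fun s => c * expR (c * s)) =
  expR (c * t) - expR (c * u).
Proof.
rewrite le_eqVlt => /predU1P[->|ut].
  by rewrite subrr set_itv1 Rintegral_set1.
have dF (x : R) : is_derive x 1 (fun s : R => expR (c * s)) (c * expR (c * x)).
  have dc : is_derive x 1 (fun s : R => c * s) c.
    by rewrite -[X in is_derive _ _ _ X]mulr1; exact: is_deriveZ.
  have := is_derive1_comp (is_derive_expR (c * x)) dc.
  by rewrite mulrC.
have cF : continuous (fun s : R => expR (c * s)).
  by move=> s; apply: differentiable_continuous; apply/derivable1_diffP; exact: ex_derive.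
rewrite /Rintegral (@continuous_FTC2 _ _ (fun s => expR (c * s)))//.
- apply: continuous_subspaceT => s.
  by apply: cvgM; [exact: cvg_cst|exact: cF].
- split; first by move=> x _; exact: ex_derive.
  + by apply: cvg_at_right_filter; exact: cF.
  + by apply: cvg_at_left_filter; exact: cF.
- by move=> x _; rewrite derive1E; exact: derive_val.
Qed.

Lemma Rintegral_expR_primitive (t c : R) (h : R -> R) : 0 <= t ->
  mu.-integrable `[0, t] (EFin \o h) ->
  Rintegral mu `[0, t] (fun s => c * expR (c * s) * Rintegral mu `[0, s] h) =
  expR (c * t) * Rintegral mu `[0, t] h -
  Rintegral mu `[0, t] (fun u => expR (c * u) * h u).
Proof.
move=> t0 ih.
rewrite (Rintegral_triangle (phi := fun s => c * expR (c * s)))//; last first.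
  apply: continuous_itv_integrable => x.
  by apply: cvgM; [exact: cvg_cst|exact: within_continuous_expRM].
rewrite -RintegralZl// -RintegralB//; first last.
- exact/integrable_continuousM/ih/within_continuous_expRM.
- exact: integrable_EFinZl.
apply: eq_Rintegral => u; rewrite inE/= in_itv/= => /andP[_ ut].
by rewrite Rintegral_expRM// mulrBl.
Qed.
End exponential_weights.

Section scalar_resolvent.
Context {R : realType}.
Notation mu := (@lebesgue_measure R).

Lemma ae_eq_Rintegral (D : set R) (g h : R -> R) : measurable D ->
  measurable_fun D g -> measurable_fun D h ->
  {ae mu, forall x, D x -> g x = h x} -> Rintegral mu D g = Rintegral mu D h.
Proof.
move=> mD mg mh gh; congr fine; apply: ae_eq_integral => //.
- exact/measurable_EFinP.
- exact/measurable_EFinP.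
- move: gh; apply: filterS; first exact: (ae_filter_ringOfSetsType mu).
  by move=> x gh Dx; rewrite gh.
Qed.

Lemma integrable_subitv0 (t : R) (h : R -> R) : t <= 1 ->
  mu.-integrable `[0, 1] (EFin \o h) -> mu.-integrable `[0, t] (EFin \o h).
Proof.
move=> t1; apply: integrableS => //.
by apply: subset_itvl; rewrite bnd_simp.
Qed.

Lemma resolvent_primitive (m t : R) (f g : R -> R) : 0 <= t -> t <= 1 ->
  mu.-integrable `[0, 1] (EFin \o f) -> mu.-integrable `[0, 1] (EFin \o g) ->
  {ae mu, forall s, `[0, 1]%classic s ->
    g s = m * f s + m * Rintegral mu `[0, s] g} ->
  Rintegral mu `[0, t] g =
  m * (expR (m * t) * Rintegral mu `[0, t] (fun s => expR (- m * s) * f s)).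
Proof.
move=> t0 t1 /(integrable_subitv0 t1) jf /(integrable_subitv0 t1) jg geq.
have cG := within_continuous_primitive jg.
have iG := continuous_itv_integrable cG.
have ieG := integrable_continuousM (within_continuous_expRM (c := - m)) iG.
have ief := integrable_continuousM (within_continuous_expRM (c := - m)) jf.
have ieg := integrable_continuousM (within_continuous_expRM (c := - m)) jg.
have := Rintegral_expR_primitive (- m) t0 jg.
rewrite (_ : Rintegral mu `[0, t] (fun u => expR (- m * u) * g u) =
  m * Rintegral mu `[0, t] (fun u => expR (- m * u) * f u) +
  m * Rintegral mu `[0, t]
        (fun u => expR (- m * u) * Rintegral mu `[0, u] g)); last first.
  rewrite -!RintegralZl// -RintegralD//; [|exact: integrable_EFinZl..].
  apply: ae_eq_Rintegral => //.
  - by apply/measurable_EFinP; exact: measurable_int ieg.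
  - apply/measurable_EFinP; apply: (measurable_int mu).
    by apply: integrable_EFinD => //; exact: integrable_EFinZl.
  - move: geq; apply: filterS; first exact: (ae_filter_ringOfSetsType mu).
    move=> s /=; rewrite !in_itv/= => + /andP[s0 st].
    rewrite s0 (le_trans st t1) => ->//.
    by rewrite mulrDr !(mulrCA _ m).
under eq_Rintegral do rewrite -mulrA.
rewrite RintegralZl// => H.
have {H} : expR (- m * t) * Rintegral mu `[0, t] g =
    m * Rintegral mu `[0, t] (fun u => expR (- m * u) * f u) by lra.
move=> /(congr1 ( *%R (expR (m * t)))).
by rewrite mulrA -expRD mulNr subrr expR0 mul1r => ->; rewrite mulrCA.
Qed.

(* [(1/m - V)^{-1} f], as the solution of [g = m f + m V g]. *)
Definition resolvent_fun (m : R) (f : R -> R) (t : R) : R :=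
  m * f t + m * (m * (expR (m * t) *
    Rintegral mu `[0, t] (fun s => expR (- m * s) * f s))).

Lemma within_continuous_resolvent_term (m : R) (f : R -> R) :
  mu.-integrable `[0, 1] (EFin \o f) ->
  {within `[0, 1], continuous (fun t => expR (m * t) *
    Rintegral mu `[0, t] (fun s => expR (- m * s) * f s))}.
Proof.
move=> jf x; apply: cvgM; first exact: within_continuous_expRM.
apply: within_continuous_primitive.
exact/integrable_continuousM/jf/within_continuous_expRM.
Qed.

Lemma resolvent_funE (m t : R) (f : R -> R) : 0 <= t -> t <= 1 ->
  mu.-integrable `[0, 1] (EFin \o f) ->
  resolvent_fun m f t =
  m * f t + m * Rintegral mu `[0, t] (resolvent_fun m f).
Proof.
move=> t0 t1 jf1; have jf := integrable_subitv0 t1 jf1.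
congr (_ + m * _); rewrite /resolvent_fun.
have ih := integrable_continuousM (within_continuous_expRM (c := - m)) jf.
have iw : mu.-integrable `[0, t] (EFin \o (fun s => expR (m * s) *
    Rintegral mu `[0, s] (fun s => expR (- m * s) * f s))).
  apply: integrable_subitv0 => //; apply: continuous_itv_integrable.
  exact: within_continuous_resolvent_term.
rewrite RintegralD//; first last.
- by do 2 apply: integrable_EFinZl => //.
- exact: integrable_EFinZl.
rewrite RintegralZl// RintegralZl//; last exact: integrable_EFinZl.
have := Rintegral_expR_primitive m t0 ih.
under eq_Rintegral do rewrite -mulrA.
rewrite RintegralZl// => ->.
under [X in _ - X]eq_Rintegral do
  rewrite mulrA -expRD mulNr subrr expR0 mul1r.
by rewrite mulrBr addrC subrK.
Qed.
End scalar_resolvent.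

Section step_approximation.
Context {R : realType}.
Notation mu := (@lebesgue_measure R).

Lemma Rintegral_sum (D : set R) (n : nat) (F : nat -> R -> R) : measurable D ->
  (forall k, mu.-integrable D (EFin \o F k)) ->
  Rintegral mu D (fun s => \sum_(k < n) F k s) =
  \sum_(k < n) Rintegral mu D (F k).
Proof.
move=> mD iF; elim: n => [|n IHn].
  under eq_Rintegral do rewrite big_ord0.
  by rewrite Rintegral_cst// mul0r big_ord0.
under eq_Rintegral do rewrite big_ord_recr.
rewrite RintegralD// ?IHn ?big_ord_recr// (_ : _ \o _ =
  (fun s => \sum_(k < n) (EFin \o F k) s)%E); last first.
  by apply/funext => s; rewrite /= sumEFin.
exact: integrable_sum.
Qed.

Lemma cvg_expRMn0 (a : R) : a < 0 -> expR (n%:R * a) @[n --> \oo] --> (0 : R).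
Proof.
move=> a0; under eq_cvg do rewrite expRM_natl.
by apply: cvg_expr; rewrite ger0_norm ?expR_ge0// expR_lt1.
Qed.

Lemma ler_1BMn_exprn (z : R) (n : nat) : 0 <= z <= 1 ->
  1 - n%:R * z <= (1 - z) ^+ n.
Proof.
move=> /andP[z0 z1]; elim: n => [|n IHn]; first by rewrite expr0 mul0r subr0.
rewrite exprSr; apply: (@le_trans _ _ ((1 - n%:R * z) * (1 - z))).
  rewrite -natr1.
  have : 0 <= n%:R * z * z by rewrite !mulr_ge0.
  nra.
by rewrite ler_wpM2r// subr_ge0.
Qed.

(* The exponent of [step_approx] exceeds [expR n], so that its base stays in
   [0, 1] for [t <= 1] and [s >= 0]. *)
Definition step_deg (n : nat) : nat := Num.bound (expR n%:R : R).

Definition step_approx (t : R) (n : nat) (s : R) : R :=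
  (1 - expR (n%:R * (t - s)) / (step_deg n)%:R) ^+ step_deg n.

Lemma step_deg_gt n : expR n%:R < (step_deg n)%:R :> R.
Proof. by apply: archi_boundP; exact: expR_ge0. Qed.

Lemma step_deg_gt0 n : 0 < (step_deg n)%:R :> R.
Proof. exact: lt_trans (expR_gt0 _) (step_deg_gt n). Qed.

Lemma step_base_itv (t s : R) n : t <= 1 -> 0 <= s ->
  0 <= expR (n%:R * (t - s)) / (step_deg n)%:R <= 1.
Proof.
move=> t1 s0; rewrite divr_ge0 ?expR_ge0//=.
rewrite ler_pdivrMr ?step_deg_gt0// mul1r.
apply: le_trans (ltW (step_deg_gt n)); rewrite ler_expR.
have : 0 <= n%:R :> R by []. nra.
Qed.

Lemma step_approx_itv (t s : R) n : t <= 1 -> 0 <= s ->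
  0 <= step_approx t n s <= 1.
Proof.
move=> t1 s0; have /andP[z0 z1] := step_base_itv n t1 s0.
by rewrite exprn_ge0 ?exprn_ile1 ?subr_ge0// gerBl.
Qed.

Lemma cvg_step_approx_lt (t s : R) : t <= 1 -> 0 <= s -> s < t ->
  step_approx t n s @[n --> \oo] --> (0 : R).
Proof.
move=> t1 s0 st.
have := @cvg_expRMn0 (s - t); rewrite subr_lt0 => /(_ st).
apply: squeeze_cvgr; last exact: cvg_cst.
near=> n; have /andP[-> _]/= := step_approx_itv n t1 s0.
have /andP[z0 z1] := step_base_itv n t1 s0.
apply: (@le_trans _ _ (expR (- expR (n%:R * (t - s))))).
  rewrite (_ : - expR (n%:R * (t - s)) =
    (step_deg n)%:R * - (expR (n%:R * (t - s)) / (step_deg n)%:R)); last first.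
    by rewrite mulrN (mulrC (step_deg n)%:R) divfK// gt_eqF// step_deg_gt0.
  rewrite [leRHS]expRM_natl /step_approx lerXn2r// ?nnegrE ?subr_ge0 ?expR_ge0//.
  exact: expR_ge1Dx.
rewrite ler_expR -(opprB t s) mulrN lerN2.
by apply: le_trans (expR_ge1Dx _); rewrite lerDr.
Unshelve. all: by end_near. Qed.

Lemma cvg_step_approx_gt (t s : R) : t <= 1 -> 0 <= s -> t < s ->
  step_approx t n s @[n --> \oo] --> (1 : R).
Proof.
move=> t1 s0 ts.
have := @cvg_expRMn0 (t - s); rewrite subr_lt0 => /(_ ts) H.
have {H} : 1 - expR (n%:R * (t - s)) @[n --> \oo] --> (1 : R).
  by rewrite -[X in _ --> X]subr0; apply: cvgB => //; exact: cvg_cst.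
move=> H; apply: squeeze_cvgr H (cvg_cst _).
near=> n; have /andP[_ ->]/= := step_approx_itv n t1 s0.
rewrite andbT.
apply: le_trans (ler_1BMn_exprn _ (step_base_itv n t1 s0)).
by rewrite (mulrC (step_deg n)%:R) divfK// gt_eqF// step_deg_gt0.
Unshelve. all: by end_near. Qed.

Lemma step_approxE (t s : R) n : step_approx t n s =
  \sum_(k < (step_deg n).+1) (-1) ^+ k * ((step_deg n)%:R^-1 ^+ k *
    'C(step_deg n, k)%:R * expR ((k * n)%:R * (t - 1))) *
    expR ((k * n)%:R * (1 - s)).
Proof.
rewrite /step_approx exprDn; apply: eq_bigr => k _.
rewrite expr1n mul1r -[LHS]mulr_natr [in LHS]exprNn [in LHS]exprMn -expRM_natl.
rewrite (_ : k%:R * (n%:R * (t - s)) =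
  (k * n)%:R * (t - 1) + (k * n)%:R * (1 - s)); last by rewrite natrM; ring.
rewrite expRD; ring.
Qed.

Lemma Rintegral_step_approx_le (t eps : R) (n : nat) (f : R -> R) :
  mu.-integrable `[0, 1] (EFin \o f) ->
  (forall k, (0 < k)%N ->
    `|Rintegral mu `[0, 1] (fun s => expR ((k * n)%:R * (1 - s)) * f s)| <=
    expR (eps * (k * n)%:R)) ->
  `|Rintegral mu `[0, 1] (fun s => step_approx t n s * f s) -
    Rintegral mu `[0, 1] f| <= expR (expR (n%:R * (t - 1 + eps))) - 1.
Proof.
move=> jf Hf.
set N := step_deg n.
pose c k : R := N%:R^-1 ^+ k * 'C(N, k)%:R * expR ((k * n)%:R * (t - 1)).
have c_ge0 k : 0 <= c k.
  by rewrite !mulr_ge0 ?expR_ge0// exprn_ge0// invr_ge0.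
pose J k := Rintegral mu `[0, 1] (fun s => expR ((k * n)%:R * (1 - s)) * f s).
have iJ k : mu.-integrable `[0, 1]
    (EFin \o (fun s => expR ((k * n)%:R * (1 - s)) * f s)).
  apply: integrable_continuousM jf; apply: continuous_subspaceT => s.
  apply: continuous_comp; last exact: continuous_expR.
  by apply: cvgM; [exact: cvg_cst|apply: cvgB => //; exact: cvg_cst].
have -> : Rintegral mu `[0, 1] (fun s => step_approx t n s * f s) =
    \sum_(k < N.+1) (-1) ^+ k * c k * J k.
  pose F k s := (-1) ^+ k * c k * (expR ((k * n)%:R * (1 - s)) * f s).
  transitivity (Rintegral mu `[0, 1] (fun s => \sum_(k < N.+1) F k s)).
    apply: eq_Rintegral => s _; rewrite step_approxE mulr_suml.
    by apply: eq_bigr => k _; rewrite /F /c !mulrA.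
  rewrite Rintegral_sum// => [|k]; last exact: integrable_EFinZl.
  by apply: eq_bigr => k _; rewrite RintegralZl.
rewrite big_ord_recl /= expr0 mul1r.
have -> : c 0%N = 1.
  by rewrite /c expr0 bin0 mul0n mul0r expR0 !mulr1.
have -> : J 0%N = Rintegral mu `[0, 1] f.
  by apply: eq_Rintegral => s _; rewrite mul0n mul0r expR0 mul1r.
rewrite mul1r addrAC subrr add0r.
set q := expR (n%:R * (t - 1 + eps)).
apply: (@le_trans _ _ (\sum_(i < N) N%:R^-1 ^+ i.+1 * 'C(N, i.+1)%:R * q ^+ i.+1)).
  apply: (le_trans (ler_norm_sum _ _ _)); apply: ler_sum => i _.
  rewrite normrM (normrM ((-1) ^+ _)) normrX normrN1 expr1n mul1r (ger0_norm (c_ge0 _)).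
  apply: (le_trans (ler_wpM2l (c_ge0 _) (Hf _ _))) => //.
  rewrite /c -[leLHS]mulrA ler_wpM2l//.
  rewrite -expRD /q -expRM_natl ler_expR.
  by rewrite /bump /= add1n natrM le_eqVlt; apply/orP; left; apply/eqP; ring.
have N0 : 0 < N%:R :> R := step_deg_gt0 n.
have q0 : 0 <= q by exact: expR_ge0.
rewrite [leLHS](_ : _ = (1 + q / N%:R) ^+ N - 1); last first.
  rewrite exprDn [in RHS]big_ord_recl /= expr1n expr0 bin0 mulr1n mul1r.
  rewrite addrAC subrr add0r; apply: eq_bigr => i _.
  rewrite expr1n mul1r -mulr_natr exprMn /bump /= add1n.
  ring.
rewrite lerD2r [X in expR X](_ : q = N%:R * (q / N%:R)); last first.
  by rewrite mulrCA divff ?mulr1// gt_eqF.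
rewrite [leRHS]expRM_natl lerXn2r// ?nnegrE ?expR_ge0//.
  by rewrite addr_ge0// divr_ge0// ltW.
exact: expR_ge1Dx.
Qed.
End step_approximation.

Section subexponential_vanishing.
Context {R : realType}.
Notation mu := (@lebesgue_measure R).

Lemma ae_neq (a : R) : {ae mu, forall x, x != a}.
Proof.
exists [set a]; split => //; first exact: lebesgue_measure_set1.
by move=> x /= /negP; rewrite negbK => /eqP.
Qed.

Lemma cvg_Rintegral_dominated (D : set R) (F_ : nat -> R -> R) (F g : R -> R) :
  measurable D -> (forall n, measurable_fun D (F_ n)) -> measurable_fun D F ->
  {ae mu, forall x, D x -> F_ n x @[n --> \oo] --> F x} ->
  mu.-integrable D (EFin \o g) ->
  (forall n x, D x -> `|F_ n x| <= g x) ->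
  Rintegral mu D (F_ n) @[n --> \oo] --> Rintegral mu D F.
Proof.
move=> mD mF_ mF FF ig Fg.
have FFe : {ae mu, forall x, D x -> (EFin \o F_ n) x @[n --> \oo] --> (EFin \o F) x}.
  move: FF; apply: filterS; first exact: (ae_filter_ringOfSetsType mu).
  by move=> x FFx Dx; apply: cvg_EFin; [exact: nearW|exact: FFx].
have Fge : {ae mu, forall x n, D x -> (`|(EFin \o F_ n) x| <= (EFin \o g) x)%E}.
  by apply: aeW => x n Dx; rewrite lee_fin Fg.
have [iF _ H] := @dominated_convergence _ _ _ mu D mD
  (fun n => EFin \o F_ n) (EFin \o F) (EFin \o g) (fun n => (measurable_EFinP _ _).2 (mF_ n))
  ((measurable_EFinP _ _).2 mF) FFe ig Fge.
by apply: fine_cvg; rewrite fineK ?integrable_fin_num.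
Qed.

Lemma measurable_step_approx (D : set R) (t : R) n :
  measurable_fun D (step_approx t n).
Proof.
apply: measurable_funX; apply: measurable_funB => //.
apply: measurable_funM => //; apply: measurableT_comp => //.
by apply: measurable_funM => //; apply: measurable_funB.
Qed.

Definition subexponential_moments (f : R -> R) :=
  forall eps, 0 < eps -> exists N : nat, forall m, (N <= m)%N ->
    `|Rintegral mu `[0, 1] (fun s => expR (m%:R * (1 - s)) * f s)| <=
    expR (eps * m%:R).

Lemma Rintegral_prefix_eq0 (f : R -> R) (t : R) : 0 <= t < 1 ->
  mu.-integrable `[0, 1] (EFin \o f) -> subexponential_moments f ->
  Rintegral mu `[0, t] f = 0.
Proof.
move=> /andP[t0 t1] jf sf.
have mf : measurable_fun (`[0, 1] : set R) f.
  by apply/measurable_EFinP; exact: measurable_int jf.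
pose I n := Rintegral mu `[0, 1] (fun s => step_approx t n s * f s).
have cvg1 : I n @[n --> \oo] --> Rintegral mu `[0, 1] f.
  have e0 : 0 < (1 - t) / 2 by rewrite divr_gt0// subr_gt0.
  have [N HN] := sf _ e0.
  have u0 : expR (expR (n%:R * ((t - 1) / 2))) - 1 @[n --> \oo] --> (0 : R).
    have -> : (0 : R) = expR 0 - 1 by rewrite expR0 subrr.
    apply: cvgB; last exact: cvg_cst.
    apply: continuous_cvg; first exact: continuous_expR.
    by apply: cvg_expRMn0; rewrite pmulr_llt0// subr_lt0.
  apply/cvgrPdist_le => e e_gt0.
  move/cvgrPdist_le : u0 => /(_ _ e_gt0); apply: filterS2; last first.
    exact: (nbhs_infty_ge N).
  move=> n Nn uen; rewrite distrC.
  have Hk k : (0 < k)%N ->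
      `|Rintegral mu `[0, 1] (fun s => expR ((k * n)%:R * (1 - s)) * f s)| <=
      expR ((1 - t) / 2 * (k * n)%:R).
    by move=> k0; apply: HN; rewrite (leq_trans Nn)// leq_pmull.
  apply: le_trans (Rintegral_step_approx_le t jf Hk) _.
  move: uen; rewrite sub0r normrN (_ : (t - 1) / 2 = t - 1 + (1 - t) / 2).
    by apply: le_trans; exact: ler_norm.
  by field.
have cvg2 : I n @[n --> \oo] --> Rintegral mu `[0, 1] (f \_ `]t, 1]).
  apply: (cvg_Rintegral_dominated (g := fun s => `|f s|)) => //.
  - by move=> n; apply: measurable_funM => //; exact: measurable_step_approx.
  - apply/measurable_restrict => //.
    by apply: measurable_funS mf => //; apply: subIset; left.
  - move: (ae_neq t); apply: filterS; first exact: (ae_filter_ringOfSetsType mu).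
    move=> s st /=; rewrite in_itv/= => /andP[s0 s1].
    rewrite patchE mem_setE in_itv/= s1 andbT.
    move: st; rewrite neq_lt => /orP[st|ts].
      rewrite ltNge (ltW st)/= -[X in _ --> X](mul0r (f s)); apply: cvgM; last exact: cvg_cst.
      by apply: cvg_step_approx_lt => //; exact: ltW.
    rewrite ts -[X in _ --> X](mul1r (f s)); apply: cvgM; last exact: cvg_cst.
    by apply: cvg_step_approx_gt => //; exact: ltW.
  - exact: integrable_norm.
  - move=> n s /=; rewrite in_itv/= => /andP[s0 s1].
    have /andP[p0 p1] := step_approx_itv n (ltW t1) s0.
    by rewrite normrM (ger0_norm p0) ler_piMl.
have : Rintegral mu `[0, 1] f = Rintegral mu `[0, 1] (f \_ `]t, 1]).
  exact: (cvg_unique (@Rhausdorff R) cvg1 cvg2).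
rewrite -Rintegral_mkcondr setIidr; last first.
  by apply: subset_itvr; rewrite bnd_simp.
rewrite -(Rintegral_itvB (x := t) jf) ?bnd_simp ?(ltW t1)// => ?; lra.
Qed.

Lemma subexponential_moments_ae0 (f : R -> R) :
  mu.-integrable `[0, 1] (EFin \o f) -> subexponential_moments f ->
  {ae mu, forall x, `[0, 1]%classic x -> f x = 0}.
Proof.
move=> jf sf.
have ifp := integrable_EFin_patch (measurable_itv _) jf.
have lfp : locally_integrable setT (f \_ `[0, 1]).
  by apply: integrable_locally.
have := FTC1 (a := BLeft 0) (f := f \_ `[0, 1]) _ lfp.
have ify y : mu.-integrable `[0, y] (EFin \o f \_ `[0, 1]).
  by apply: integrableS ifp.
move=> /(_ ify) H.
have := ae_neq 1; have := ae_neq 0; move: H.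
apply: filterS3; first exact: (ae_filter_ringOfSetsType mu).
move=> x H x0 x1 /=; rewrite in_itv/= => /andP[le0x lex1].
have {}x0 : 0 < x by rewrite lt_neqAle eq_sym x0.
have {}x1 : x < 1 by rewrite lt_neqAle x1.
move: H; rewrite lte_fin => /(_ x0)[_].
rewrite patchE mem_setE in_itv/= le0x lex1/= => <-.
rewrite derive1E (near_eq_derive (g := cst 0)) ?derive_cst//.
near=> y.
have y01 : 0 <= y < 1.
  have : y \in `]0, 1[ by near: y; apply: near_in_itvoo; rewrite in_itv/= x0.
  by rewrite in_itv/= => /andP[/ltW -> ->].
rewrite -[RHS](Rintegral_prefix_eq0 y01 jf sf).
apply: eq_Rintegral => s; rewrite inE/= in_itv/= => /andP[s0 sy].
rewrite patchE mem_setE in_itv/= s0 (le_trans sy)//.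
by have /andP[_ /ltW] := y01.
Unshelve. all: by end_near. Qed.
End subexponential_vanishing.

Section L2_estimates.
Context {R : realType}.
Notation mu := (@lebesgue_measure R).

Definition sqnorm (h : R -> R) : R := Rintegral mu `[0, 1] (fun x => h x ^+ 2).

Lemma sqnorm_ge0 h : 0 <= sqnorm h.
Proof. by apply: Rintegral_ge0 => x _; exact: sqr_ge0. Qed.

Lemma measurable_sqr (h : R -> R) : measurable_fun (I01 R) h ->
  measurable_fun (I01 R) (fun x => h x ^+ 2).
Proof. by move=> mh; exact: measurable_funX. Qed.

Lemma sqint_ltyP (h : R -> R) : measurable_fun (I01 R) h ->
  (sqint h < +oo)%E <-> mu.-integrable `[0, 1] (EFin \o (fun x => h x ^+ 2)).
Proof.
move=> mh.
have e : (\int[mu]_(x in `[0%R, 1%R]) `|((h x) ^+ 2)%:E|)%E = sqint h.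
  by apply: eq_integral => x _; rewrite gee0_abs// lee_fin sqr_ge0.
split=> [h2|/integrableP[_]]; last by rewrite e.
apply/integrableP; split; last by rewrite e.
by apply/measurable_EFinP; exact: measurable_sqr.
Qed.

Lemma integrable_cst01 (c : R) : mu.-integrable `[0, 1] (EFin \o cst c).
Proof.
by apply: continuous_itv_integrable; apply: continuous_subspaceT; exact: cst_continuous.
Qed.

Lemma Rintegral_cst01 (c : R) : Rintegral mu `[0, 1] (fun=> c) = c.
Proof.
by rewrite Rintegral_cst//= lebesgue_measure_itv/= lte_fin ltr01 sube0/= mulr1.
Qed.

Lemma integrable_of_sqr (h : R -> R) : measurable_fun (I01 R) h ->
  mu.-integrable `[0, 1] (EFin \o (fun x => h x ^+ 2)) ->
  mu.-integrable `[0, 1] (EFin \o h).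
Proof.
move=> mh ih2.
apply: (le_integrable _ _ _ (integrable_EFinD _ (integrable_cst01 1) ih2)) => //.
  exact/measurable_EFinP.
move=> x _; rewrite /= lee_fin [leRHS]ger0_norm ?addr_ge0 ?sqr_ge0// -real_normK ?num_real//.
by have : 0 <= `|h x| by []; nra.
Qed.

Lemma Rintegral_normr_le (h : R -> R) : measurable_fun (I01 R) h ->
  mu.-integrable `[0, 1] (EFin \o (fun x => h x ^+ 2)) ->
  Rintegral mu `[0, 1] (fun x => `|h x|) <= 1 + sqnorm h.
Proof.
move=> mh ih2; have ih := integrable_of_sqr mh ih2.
rewrite -[X in X + _]Rintegral_cst01 -RintegralD//; last exact: (integrable_cst01 1).
apply: le_Rintegral => //; first exact: (integrable_norm ih).
  exact: (integrable_EFinD _ (integrable_cst01 1) ih2).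
move=> x _; rewrite -[h x ^+ 2]real_normK ?num_real//.
by have : 0 <= `|h x| by []; nra.
Qed.

Lemma normr_Rintegral_le (h : R -> R) : measurable_fun (I01 R) h ->
  mu.-integrable `[0, 1] (EFin \o (fun x => h x ^+ 2)) ->
  `|Rintegral mu `[0, 1] h| <= 1 + sqnorm h.
Proof.
move=> mh ih2; apply: le_trans (Rintegral_normr_le mh ih2).
by apply: le_normr_Rintegral => //; exact: integrable_of_sqr.
Qed.

Lemma sqr_addr_le (a b : R) : (a + b) ^+ 2 <= 2 * a ^+ 2 + 2 * b ^+ 2.
Proof. by have := sqr_ge0 (a - b); rewrite !expr2; nra. Qed.

Lemma integrable_sqr_add (g h : R -> R) :
  measurable_fun (I01 R) g -> measurable_fun (I01 R) h ->
  mu.-integrable `[0, 1] (EFin \o (fun x => g x ^+ 2)) ->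
  mu.-integrable `[0, 1] (EFin \o (fun x => h x ^+ 2)) ->
  mu.-integrable `[0, 1] (EFin \o (fun x => (g x + h x) ^+ 2)).
Proof.
move=> mg mh ig ih.
apply: (le_integrable _ _ _ (integrable_EFinD _
  (integrable_EFinZl 2 _ ig) (integrable_EFinZl 2 _ ih))) => //.
  by apply/measurable_EFinP; apply: measurable_sqr; exact: measurable_funD.
move=> x _; rewrite /= lee_fin [leLHS]ger0_norm ?sqr_ge0//.
by apply: (le_trans (sqr_addr_le _ _)); exact: ler_norm.
Qed.

Lemma integrable_resolvent_fun_sqr (m : R) (f : R -> R) :
  measurable_fun (I01 R) f ->
  mu.-integrable `[0, 1] (EFin \o (fun x => f x ^+ 2)) ->
  measurable_fun (I01 R) (resolvent_fun m f) /\
  mu.-integrable `[0, 1] (EFin \o (fun x => resolvent_fun m f x ^+ 2)).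
Proof.
move=> mf if2; have jf := integrable_of_sqr mf if2.
have cw := within_continuous_resolvent_term (m := m) jf.
have mmf : measurable_fun (I01 R) (fun x => m * f x) by exact: measurable_funM.
set w : R -> R := (fun t => expR (m * t) * _) in cw.
have cw2 : {within `[0, 1], continuous (fun t : R => m * (m * w t))}.
  by move=> x; apply: cvgM; [exact: cvg_cst|apply: cvgM; [exact: cvg_cst|exact: cw]].
have mw : measurable_fun (I01 R) (fun t => m * (m * w t)).
  by apply: subspace_continuous_measurable_fun cw2; exact: measurable_itv.
split; first exact: measurable_funD.
apply: integrable_sqr_add => //.
  rewrite (_ : (fun x => (m * f x) ^+ 2) = (fun x => m ^+ 2 * f x ^+ 2)).
    exact: integrable_EFinZl.
  by apply/funext => x; rewrite exprMn.
apply: continuous_itv_integrable => x.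
by apply: cvgM; exact: cw2.
Qed.

Lemma resolvent_sqnorm_le (m : R) (f g : R -> R) : 0 <= m ->
  measurable_fun (I01 R) f -> measurable_fun (I01 R) g ->
  mu.-integrable `[0, 1] (EFin \o (fun x => f x ^+ 2)) ->
  mu.-integrable `[0, 1] (EFin \o (fun x => g x ^+ 2)) ->
  {ae mu, forall s, `[0, 1]%classic s ->
    g s = m * f s + m * Rintegral mu `[0, s] g} ->
  sqnorm g <= 2 * m ^+ 2 * sqnorm f +
    2 * m ^+ 2 * (m * (expR m * (1 + sqnorm f))) ^+ 2.
Proof.
move=> m0 mf mg if2 ig2 geq.
have jf := integrable_of_sqr mf if2; have jg := integrable_of_sqr mg ig2.
set K := m * _.
pose G s := Rintegral mu `[0, s] g.
have GK s : `[0, 1]%classic s -> G s ^+ 2 <= K ^+ 2.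
  rewrite /= in_itv/= => /andP[s0 s1].
  rewrite -[leLHS]real_normK ?num_real// lerXn2r ?nnegrE//.
    by rewrite !mulr_ge0 ?expR_ge0// addr_ge0// sqnorm_ge0.
  have jfs := integrable_subitv0 s1 jf.
  have jef := integrable_continuousM (within_continuous_expRM (c := - m)) jfs.
  rewrite /G (resolvent_primitive s0 s1 jf jg geq) normrM (ger0_norm m0) ler_wpM2l//.
  rewrite normrM ger0_norm ?expR_ge0// ler_pM ?expR_ge0//.
    by rewrite ler_expR ler_piMr.
  apply: le_trans (Rintegral_normr_le mf if2).
  apply: (le_trans (le_normr_Rintegral _ jef)) => //.
  apply: (@le_trans _ _ (Rintegral mu `[0, s] (fun x => `|f x|))).
    apply: le_Rintegral => //.
    - exact: (integrable_norm jef).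
    - exact: (integrable_norm jfs).
    move=> x /=; rewrite in_itv/= => /andP[x0 _].
    rewrite normrM ler_piMl// ger0_norm ?expR_ge0//.
    by rewrite -expR0 ler_expR mulNr oppr_le0 mulr_ge0.
  apply: fine_le.
  - by apply: integrable_fin_num => //; exact: (integrable_norm jfs).
  - by apply: integrable_fin_num => //; exact: (integrable_norm jf).
  apply: ge0_subset_integral => //.
  - by apply/measurable_EFinP; apply: measurableT_comp.
  - by apply: subset_itvl; rewrite bnd_simp.
have mG : measurable_fun (I01 R) G.
  apply: subspace_continuous_measurable_fun; first exact: measurable_itv.
  exact: within_continuous_primitive.
pose g' s := m * f s + m * G s.
have mg' : measurable_fun (I01 R) g'.
  by apply: measurable_funD; exact: measurable_funM.
have gg' : {ae mu, forall s, `[0, 1]%classic s -> g s ^+ 2 = g' s ^+ 2}.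
  move: geq; apply: filterS; first exact: (ae_filter_ringOfSetsType mu).
  by move=> s gs s01; rewrite gs.
have -> : sqnorm g = sqnorm g'.
  by apply: ae_eq_Rintegral => //; exact: measurable_sqr.
rewrite -[X in _ + X]Rintegral_cst01 -RintegralZl// -RintegralD//; first last.
- exact: integrable_cst01.
- exact: integrable_EFinZl.
have iub : mu.-integrable `[0, 1] (EFin \o
    (fun s => 2 * m ^+ 2 * f s ^+ 2 + 2 * m ^+ 2 * K ^+ 2)).
  apply: integrable_EFinD => //; first exact: integrable_EFinZl.
  exact: (integrable_cst01 (2 * m ^+ 2 * K ^+ 2)).
have le2 s : `[0, 1]%classic s ->
    g' s ^+ 2 <= 2 * m ^+ 2 * f s ^+ 2 + 2 * m ^+ 2 * K ^+ 2.
  move=> s01; apply: (le_trans (sqr_addr_le _ _)).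
  rewrite [(m * f s) ^+ 2]exprMn [(m * G s) ^+ 2]exprMn -!mulrA lerD2l.
  by rewrite !ler_wpM2l ?sqr_ge0// GK.
apply: le_Rintegral => //.
apply: le_integrable iub => //; first by apply/measurable_EFinP; exact: measurable_sqr.
move=> s s01; rewrite /= lee_fin ger0_norm ?sqr_ge0//.
by rewrite (le_trans (le2 s s01))// ler_norm.
Qed.
End L2_estimates.

Section volterra_resolvent.
Context {R : realType}.
Notation mu := (@lebesgue_measure R).
Implicit Types (m : R) (f g x : cfun R).

Lemma inL2P f : inL2 f <->
  [/\ measurable_fun (I01 R) f.1, measurable_fun (I01 R) f.2,
    mu.-integrable `[0, 1] (EFin \o (fun s => f.1 s ^+ 2)) &
    mu.-integrable `[0, 1] (EFin \o (fun s => f.2 s ^+ 2))].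
Proof.
split=> [[m1 m2 i1 i2]|[m1 m2 i1 i2]]; split => //.
- exact: (sqint_ltyP m1).1.
- exact: (sqint_ltyP m2).1.
- exact: (sqint_ltyP m1).2.
- exact: (sqint_ltyP m2).2.
Qed.

Lemma L2norm_ge0 f : 0 <= L2norm f.
Proof. exact: sqrtr_ge0. Qed.

Lemma sqr_L2norm f : inL2 f -> L2norm f ^+ 2 = sqnorm f.1 + sqnorm f.2.
Proof.
move=> [_ _ i1 i2].
have sge0 h : (0 <= sqint h :> \bar R)%E.
  by apply: integral_ge0 => x _; rewrite lee_fin sqr_ge0.
rewrite /L2norm fineD ?ge0_fin_numE//.
by rewrite sqr_sqrtr// addr_ge0// fine_ge0.
Qed.

Definition real_resolvent_eq m (x g : R -> R) :=
  {ae mu, forall s, `[0, 1]%classic s ->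
    g s = m * x s + m * Rintegral mu `[0, s] g}.

Lemma is_resolvent_realP m x g : 0 < m ->
  is_resolvent (m^-1, 0) x g <->
  [/\ inL2 g, real_resolvent_eq m x.1 g.1 & real_resolvent_eq m x.2 g.2].
Proof.
move=> m0; have mN0 : m != 0 by rewrite gt_eqF.
have E a b c : (m^-1 * a - b = c) <-> a = m * c + m * b.
  split=> [<-|->]; last by rewrite -mulrDr mulKf// addrK.
  by rewrite -mulrDr subrK mulVKf.
split=> [[gL H]|[gL H1 H2]].
  split=> //; move: H; apply: filterS; try exact: (ae_filter_ringOfSetsType mu).
    by move=> s H /H[/= + _]; rewrite mul0r subr0 => /E.
  by move=> s H /H[/= _ +]; rewrite mul0r addr0 => /E.
split=> //; move: H1 H2; apply: filterS2; first exact: (ae_filter_ringOfSetsType mu).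
move=> s H1 H2 s01 /=; rewrite !mul0r subr0 addr0.
by split; apply/E; [exact: H1|exact: H2].
Qed.

Lemma is_resolvent_resolvent_fun m x : 0 < m -> inL2 x ->
  is_resolvent (m^-1, 0) x (resolvent_fun m x.1, resolvent_fun m x.2).
Proof.
move=> m0 /inL2P[m1 m2 i1 i2].
have [M1 I1] := integrable_resolvent_fun_sqr m m1 i1.
have [M2 I2] := integrable_resolvent_fun_sqr m m2 i2.
apply/is_resolvent_realP => //; split; first exact/inL2P.
- apply: aeW => s /=; rewrite in_itv/= => /andP[s0 s1].
  exact/resolvent_funE/integrable_of_sqr.
- apply: aeW => s /=; rewrite in_itv/= => /andP[s0 s1].
  exact/resolvent_funE/integrable_of_sqr.
Qed.

Definition resolvent_bound m (a : R) : R :=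
  2 * m ^+ 2 * a + 2 * m ^+ 2 * (m * (expR m * (1 + a))) ^+ 2.

Lemma resolvent_L2norm_le m x g : 0 < m -> inL2 x ->
  is_resolvent (m^-1, 0) x g ->
  L2norm g ^+ 2 <= resolvent_bound m (sqnorm x.1) +
    resolvent_bound m (sqnorm x.2).
Proof.
move=> m0 /inL2P[m1 m2 i1 i2] /is_resolvent_realP-/(_ m0)[gL e1 e2].
rewrite sqr_L2norm//; move/inL2P : gL => [M1 M2 I1 I2].
by rewrite lerD// resolvent_sqnorm_le// ltW.
Qed.

Lemma resolvent_L2norms_ubound m x : 0 < m -> inL2 x ->
  has_ubound [set L2norm g | g in is_resolvent (m^-1, 0) x].
Proof.
move=> m0 xL.
exists (1 + (resolvent_bound m (sqnorm x.1) + resolvent_bound m (sqnorm x.2))).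
move=> _ [g /(resolvent_L2norm_le m0 xL) H <-].
by have := L2norm_ge0 g; nra.
Qed.

Lemma L2norm_le_res_vec_norm m x g : 0 < m -> inL2 x ->
  is_resolvent (m^-1, 0) x g -> L2norm g <= res_vec_norm (m^-1, 0) x.
Proof.
move=> m0 xL rg; apply: ub_le_sup; first exact: resolvent_L2norms_ubound.
by exists g.
Qed.

Lemma res_vec_norm_unit_le m x : 1 <= m -> inL2 x -> L2norm x <= 1 ->
  res_vec_norm (m^-1, 0) x <= expR (11 * m).
Proof.
move=> m1 xL x1; have m0 : 0 < m by apply: lt_le_trans m1.
apply: ge_sup.
  by eexists; eexists; [exact: (is_resolvent_resolvent_fun m0 xL)|reflexivity].
move=> _ [g /(resolvent_L2norm_le m0 xL) H <-].
have x1' : sqnorm x.1 + sqnorm x.2 <= 1.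
  by rewrite -sqr_L2norm// expr_le1// L2norm_ge0.
have A0 := sqnorm_ge0 x.1; have B0 := sqnorm_ge0 x.2.
set E := expR m in H; have Em : 1 + m <= E by exact: expR_ge1Dx.
rewrite expRM_natl -/E.
have b a : 0 <= a -> a <= 1 -> resolvent_bound m a <= 10 * E ^+ 6.
  move=> a0 a1; rewrite /resolvent_bound -/E.
  have E1 : 1 <= E by lra.
  have mE : m ^+ 2 <= E ^+ 2 by rewrite lerXn2r ?nnegrE//; lra.
  have E26 : E ^+ 2 <= E ^+ 6 by exact: ler_weXn2l.
  have h1 : m ^+ 2 * a <= E ^+ 6.
    by rewrite (le_trans _ (le_trans mE E26))// ler_piMr// sqr_ge0.
  have h2 : m ^+ 2 * (m * (E * (1 + a))) ^+ 2 <= 4 * E ^+ 6.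
    rewrite !exprMn.
    have -> : 4 * E ^+ 6 = E ^+ 2 * (E ^+ 2 * (E ^+ 2 * 2 ^+ 2)) by ring.
    have Ea : (1 + a) ^+ 2 <= 2 ^+ 2 by rewrite lerXn2r ?nnegrE//; lra.
    have h3 : E ^+ 2 * (1 + a) ^+ 2 <= E ^+ 2 * 2 ^+ 2.
      by rewrite ler_wpM2l// sqr_ge0.
    apply: (ler_pM _ _ mE); rewrite ?sqr_ge0//.
      by rewrite mulr_ge0 ?sqr_ge0// mulr_ge0 ?sqr_ge0.
    apply: (ler_pM _ _ mE h3); rewrite ?sqr_ge0//.
    by rewrite mulr_ge0 ?sqr_ge0.
  lra.
have E2 : 2 <= E by lra.
have : L2norm g ^+ 2 <= (E ^+ 11) ^+ 2.
  apply: (le_trans H).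
  apply: (@le_trans _ _ (20 * E ^+ 6)).
    have := b _ A0 _; have := b _ B0 _; move=> /(_ ltac:(lra)) ? /(_ ltac:(lra)) ?.
    lra.
  have E5 : 2 ^+ 5 <= E ^+ 5 by rewrite lerXn2r ?nnegrE//; lra.
  have -> : (E ^+ 11) ^+ 2 = E ^+ 11 * (E ^+ 5 * E ^+ 6) by ring.
  have E11 : 1 <= E ^+ 11 by rewrite exprn_ege1//; lra.
  have E6 : 0 <= E ^+ 6 by rewrite exprn_ge0//; lra.
  have h : 20 * E ^+ 6 <= E ^+ 5 * E ^+ 6.
    by rewrite ler_wpM2r// (le_trans _ E5)//; lra.
  by rewrite (le_trans h)// ler_peMl// mulr_ge0// exprn_ge0//; lra.
by rewrite ler_pXn2r// nnegrE ?L2norm_ge0// exprn_ge0// expR_ge0.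
Qed.

Lemma Rintegral_resolvent m (x g : R -> R) :
  mu.-integrable `[0, 1] (EFin \o x) -> mu.-integrable `[0, 1] (EFin \o g) ->
  real_resolvent_eq m x g ->
  Rintegral mu `[0, 1] g =
  m * Rintegral mu `[0, 1] (fun s => expR (m * (1 - s)) * x s).
Proof.
move=> jx jg /(resolvent_primitive ler01 (lexx 1) jx jg) ->.
congr (_ * _); rewrite -RintegralZl//; last first.
  exact/integrable_continuousM/jx/within_continuous_expRM.
apply: eq_Rintegral => s _.
by rewrite mulrA -expRD mulrBr mulNr.
Qed.

Lemma normr_moment_le m x g : 1 <= m -> inL2 x -> is_resolvent (m^-1, 0) x g ->
  `|Rintegral mu `[0, 1] (fun s => expR (m * (1 - s)) * x.1 s)| <=
    1 + L2norm g ^+ 2 /\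
  `|Rintegral mu `[0, 1] (fun s => expR (m * (1 - s)) * x.2 s)| <=
    1 + L2norm g ^+ 2.
Proof.
move=> m1 /inL2P[mx1 mx2 ix1 ix2]; have m0 : 0 < m by apply: lt_le_trans m1.
move=> /is_resolvent_realP-/(_ m0)[gL e1 e2].
rewrite sqr_L2norm//; move/inL2P : gL => [M1 M2 I1 I2].
have := normr_Rintegral_le M1 I1; have := normr_Rintegral_le M2 I2.
rewrite (Rintegral_resolvent _ _ e1); [|exact: integrable_of_sqr..].
rewrite (Rintegral_resolvent _ _ e2); [|exact: integrable_of_sqr..].
have A0 := sqnorm_ge0 g.1; have B0 := sqnorm_ge0 g.2.
rewrite !normrM (gtr0_norm m0).
have key (y u v : R) : 0 <= y -> 0 <= v -> m * y <= 1 + u -> y <= 1 + (u + v).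
  by move=> y0 v0 H; nra.
by move=> h2 h1; split; last rewrite [sqnorm g.1 + _]addrC; exact: key.
Qed.

Definition cfun_one : cfun R := (cst 1, cst 0).

Lemma inL2_cfun_one : inL2 cfun_one.
Proof.
apply/inL2P; split => //=.
- rewrite (_ : (fun _ => _) = cst 1); first exact: integrable_cst01.
  by apply/funext => s; rewrite expr1n.
- rewrite (_ : (fun _ => _) = cst 0); first exact: integrable_cst01.
  by apply/funext => s; rewrite expr0n.
Qed.

Lemma L2norm_cfun_one : L2norm cfun_one = 1.
Proof.
apply/eqP; rewrite -(@eqrXn2 _ 2)// ?L2norm_ge0// sqr_L2norm//; last exact: inL2_cfun_one.
rewrite /sqnorm /=.
under eq_Rintegral do rewrite expr1n.
under [X in _ + X]eq_Rintegral do rewrite expr0n.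
by rewrite !Rintegral_cst01 addr0 expr1n.
Qed.

Lemma res_op_norm_bounds m : 5 <= m ->
  1 < res_op_norm (m^-1, 0) <= expR (11 * m).
Proof.
move=> m5; have m1 : 1 <= m by lra. have m0 : 0 < m by lra.
set S := [set res_vec_norm (m^-1, 0) x | x in [set x | inL2 x /\ L2norm x <= 1]].
have ubS : ubound S (expR (11 * m)).
  by move=> _ [x [xL x1] <-]; exact: res_vec_norm_unit_le.
have S1 : S (res_vec_norm (m^-1, 0) cfun_one).
  by exists cfun_one => //; split; [exact: inL2_cfun_one|rewrite L2norm_cfun_one].
apply/andP; split; last by apply: ge_sup => //; eexists; exact: S1.
apply: lt_le_trans (ub_le_sup _ S1); last by exists (expR (11 * m)).
have rg := is_resolvent_resolvent_fun m0 inL2_cfun_one.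
apply: lt_le_trans (L2norm_le_res_vec_norm m0 inL2_cfun_one rg).
have [+ _] := normr_moment_le m1 inL2_cfun_one rg.
set g := (_, _).
have -> : Rintegral mu `[0, 1] (fun s => expR (m * (1 - s)) * cfun_one.1 s) =
    (expR m - 1) / m.
  have := Rintegral_expRM (- m) ler01.
  rewrite mulr0 expR0 mulr1 => H.
  transitivity (Rintegral mu `[0, 1]
    (fun s => - expR m / m * (- m * expR (- m * s)))).
    apply: eq_Rintegral => s _ /=.
    rewrite mulr1 (_ : m * (1 - s) = m + - m * s); last by ring.
    rewrite expRD.
    by field; rewrite gt_eqF.
  rewrite RintegralZl//; last first.
    apply: integrable_EFinZl => //.
    by apply: continuous_itv_integrable; exact: within_continuous_expRM.
  have EE : expR m * expR (- m) = 1 by rewrite -expRD subrr expR0.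
  rewrite H; transitivity ((expR m - expR m * expR (- m)) / m).
    by field; rewrite gt_eqF.
  by rewrite EE.
rewrite ger0_norm; last first.
  by rewrite divr_ge0 ?(ltW m0)// subr_ge0 -expR0 ler_expR ltW.
rewrite ler_pdivrMr// => H.
have := expR_ge1Dxn 1 (ltW m0); rewrite (_ : 2`!%:R = 2 :> R)// => H2.
have N0 := L2norm_ge0 g.
rewrite ltNge; apply/negP => N1.
have : L2norm g ^+ 2 <= 1 by rewrite expr_le1.
have : m ^+ 2 = m * m by []. nra.
Qed.
End volterra_resolvent.

Section growth.
Context {R : realType}.
Implicit Types f x g : cfun R.

Lemma cvg_inv_nat0 : ((n%:R^-1, 0) : R * R) @[n --> \oo] --> ((0, 0) : R * R).
Proof.
apply: (@cvg_pair _ _ _ _ (nbhs (0 : R)) (nbhs (0 : R))) => /=; last exact: cvg_cst.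
by rewrite -cvg_shiftS; exact: cvg_harmonic.
Qed.

Lemma k_vec_lt_near f (eps : R) : (k_vec f < eps%:E)%E ->
  \forall n \near \oo,
    ln (res_vec_norm (n%:R^-1, 0) f) / ln (res_op_norm (n%:R^-1, 0)) < eps.
Proof.
rewrite /k_vec /limf_esup => /ereal_inf_lt[_ [V V0 <-] Veps].
have /cvg_inv_nat0 VN : nbhs ((0, 0) : R * R)
    [set y | y != (0, 0) -> V y] by exact: V0.
near=> n.
rewrite -lte_fin; apply: le_lt_trans Veps; apply: ereal_sup_ubound.
exists (n%:R^-1, 0) => //.
have n0 : (0 < n)%N by near: n; exact: nbhs_infty_gt.
have : (n%:R^-1, 0) != ((0, 0) : R * R) -> V (n%:R^-1, 0) by near: n; exact: VN.
apply; apply/negP => /eqP[] /eqP.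
by rewrite invr_eq0 pnatr_eq0 -leqn0 leqNgt n0.
Unshelve. all: by end_near. Qed.

Lemma res_vec_norm_near f (eps : R) : 0 < eps -> (k_vec f <= 0)%E ->
  \forall n \near \oo, res_vec_norm (n%:R^-1, 0) f <= expR (eps * n%:R).
Proof.
move=> eps0 kf.
have e11 : 0 < eps / 11 by rewrite divr_gt0.
have := @k_vec_lt_near f (eps / 11).
rewrite (le_lt_trans kf) ?lte_fin// => /(_ isT) H.
near=> n.
have n5 : 5 <= n%:R :> R by rewrite (ler_nat _ 5); near: n; exact: nbhs_infty_ge.
have /andP[r1 r2] := res_op_norm_bounds n5.
have lr0 : 0 < ln (res_op_norm (n%:R^-1, 0) : R) by exact: ln_gt0.
have lr11 : ln (res_op_norm (n%:R^-1, 0) : R) <= 11 * n%:R.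
  by rewrite -[leRHS]expRK ler_ln ?posrE ?expR_gt0// (lt_trans _ r1).
have [v0|v0] := leP (res_vec_norm (n%:R^-1, 0) f) 0.
  exact: le_trans v0 (expR_ge0 _).
rewrite -[leLHS]lnK ?posrE// ler_expR.
have : ln (res_vec_norm (n%:R^-1, 0) f) / ln (res_op_norm (n%:R^-1, 0)) < eps / 11.
  by near: n.
rewrite ltr_pdivrMr// => /ltW/le_trans; apply.
apply: (le_trans (ler_wpM2l (ltW e11) lr11)).
by rewrite mulrA divfK.
Unshelve. all: by end_near. Qed.

Lemma k_vec_le0_moments f : inL2 f -> (k_vec f <= 0)%E ->
  subexponential_moments f.1 /\ subexponential_moments f.2.
Proof.
move=> fL kf.
have key (eps : R) : 0 < eps -> \forall n \near \oo,
    `|Rintegral (@lebesgue_measure R) `[0, 1]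
       (fun s => expR (n%:R * (1 - s)) * f.1 s)| <= expR (eps * n%:R) /\
    `|Rintegral (@lebesgue_measure R) `[0, 1]
       (fun s => expR (n%:R * (1 - s)) * f.2 s)| <= expR (eps * n%:R).
  move=> e0; have e3 : 0 < eps / 3 by rewrite divr_gt0.
  have := res_vec_norm_near e3 kf => H.
  near=> n.
  have n1 : 1 <= n%:R :> R by rewrite (ler_nat _ 1); near: n; exact: nbhs_infty_gt.
  have n0 : 0 < n%:R :> R by exact: lt_le_trans n1.
  have rg := is_resolvent_resolvent_fun n0 fL.
  have gle := L2norm_le_res_vec_norm n0 fL rg.
  have rE : res_vec_norm (n%:R^-1, 0) f <= expR (eps / 3 * n%:R) by near: n.
  have n2 : (eps / 3)^-1 <= n%:R by near: n; exact: nbhs_infty_ger.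
  have le : 1 + L2norm (resolvent_fun n%:R f.1, resolvent_fun n%:R f.2) ^+ 2 <=
      expR (eps * n%:R).
    set y := L2norm _ in gle *.
    have y0 : 0 <= y by exact: L2norm_ge0.
    set E := expR (eps / 3 * n%:R).
    have yE : y <= E by exact: le_trans gle rE.
    have -> : expR (eps * n%:R) = E ^+ 3.
      by rewrite /E -expRM_natl; congr expR; field.
    have E2 : 2 <= E.
      apply: le_trans (expR_ge1Dx _).
      by rewrite (_ : 2 = 1 + 1)// lerD2l mulrC -ler_pdivrMr// mul1r.
    have y2 : y ^+ 2 <= E ^+ 2 by rewrite lerXn2r ?nnegrE//; lra.
    have E4 : 1 <= E ^+ 2 by rewrite exprn_ege1//; lra.
    have : 2 * E ^+ 2 <= E * E ^+ 2 by rewrite ler_wpM2r// sqr_ge0.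
    by rewrite -exprS; lra.
  have [a b] := normr_moment_le n1 fL rg.
  by split; [exact: le_trans a le|exact: le_trans b le].
split=> eps /key[N _ HN]; exists N => m /HN; first by case.
by case.
Unshelve. all: by end_near. Qed.
End growth.

(* For every f in L^2[0,1] with f <> 0 (in L^2), k_f(V) > 0. *)
Theorem theorem4p12 (R : realType) (f : cfun R) :
  inL2 f -> ~ L2eq f ((fun _ => 0), (fun _ => 0)) -> (0 < k_vec f)%E.
Proof.
move=> fL f0; rewrite ltNge; apply/negP => kf; apply: f0.
have /inL2P[m1 m2 i1 i2] := fL.
have [s1 s2] := k_vec_le0_moments fL kf.
have := subexponential_moments_ae0 (integrable_of_sqr m1 i1) s1.
have := subexponential_moments_ae0 (integrable_of_sqr m2 i2) s2.
apply: filterS2; first exact: (ae_filter_ringOfSetsType (@lebesgue_measure R)).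
by move=> s f2 f1 s01; split; [exact: f1|exact: f2].
Qed.
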